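(* Let $G$ be an AG-group and let $\mu\in F(G)$, i.e. $\mu$ is a fuzzy AG-subgroup of $G$. Then $\mu(xy)=\mu(yx)$ for all $x,y\in G$.
   Context: An AG-group is a set $G$ with a binary operation (written as juxtaposition) satisfying the left invertive law $(ab)c=(cb)a$ for all $a,b,c\in G$, such that there is a unique left identity $e\in G$ ($ea=a$ for all $a\in G$) and for every $a\in G$ there is $a^{-1}\in G$ with $a^{-1}a=aa^{-1}=e$. The operation need not be associative or commutative. A fuzzy subset of $G$ is a map $\mu:G\to[0,1]$. Write $s\wedge t=\min(s,t)$. A fuzzy subset $\mu$ is a fuzzy AG-subgroup of $G$ if for all $x,y\in G$: $\mu(xy)\ge\mu(x)\wedge\mu(y)$ and $\mu(x^{-1})\ge\mu(x)$. The set of all fuzzy AG-subgroups of $G$ is denoted $F(G)$. *)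

(* Defs.v *)
From mathcomp Require Import all_boot all_order all_algebra.
From mathcomp Require Import interval_inference reals.

Set Implicit Arguments.
Unset Strict Implicit.
Unset Printing Implicit Defensive.

Import Order.TTheory GRing.Theory Num.Theory.

Local Open Scope ring_scope.

Declare Scope ag_scope.
Delimit Scope ag_scope with AG.

(* Inversion is a field because inverses are unique, see [ag_inv_unique]. *)
Record agGroup := AGGroup {
  ag_carrier :> Type;
  ag_mul : ag_carrier -> ag_carrier -> ag_carrier;
  ag_one : ag_carrier;
  ag_inv : ag_carrier -> ag_carrier;
  ag_left_invertive : forall a b c,
    ag_mul (ag_mul a b) c = ag_mul (ag_mul c b) a;
  ag_mul1 : forall a, ag_mul ag_one a = a;
  ag_one_unique : forall f, (forall a, ag_mul f a = a) -> f = ag_one;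
  ag_mulV : forall a, ag_mul (ag_inv a) a = ag_one;
  ag_mulrV : forall a, ag_mul a (ag_inv a) = ag_one
}.

Arguments ag_one {_}.

Notation "x * y" := (ag_mul x y) : ag_scope.
Notation "x ^-1" := (ag_inv x) : ag_scope.

Lemma ag_inv_unique (G : agGroup) (a b : G) :
  (b * a)%AG = ag_one -> b = (a^-1)%AG.
Proof.
move=> ba; rewrite -[b]ag_mul1 -(ag_mulV a) ag_left_invertive ba.
exact: ag_mul1.
Qed.

(* [{i01 R}] is the library's type of elements of the closed interval [0, 1]. *)
Definition fuzzy_subset (R : realType) (G : Type) := G -> {i01 R}.

Definition fuzzy_ag_subgroup (R : realType) (G : agGroup)
    (mu : fuzzy_subset R G) : Prop :=
  (forall x y : G, Order.min (mu x) (mu y) <= mu (x * y)%AG) /\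
  (forall x : G, mu x <= mu (x^-1)%AG).

(* Main.v *)
(* The left invertive law gives (xy)e = (ey)x = yx, so right multiplication by
   e swaps the factors; and mu attains its maximum at e, since e = a^-1 a. *)
Require Import Defs.
From mathcomp Require Import all_boot all_order all_algebra.
From mathcomp Require Import interval_inference reals.

(** Since [mu] is largest at the identity e, mu(xy) = min(mu(xy), mu(e)) <= mu((xy)e), and (xy)e =
    yx by the left invertive law ([ag_mulC1]). Exchanging x and y gives the reverse inequality, so
    antisymmetry concludes. *)

Lemma ag_mulC1 (G : agGroup) (x y : G) :
  ag_mul (ag_mul x y) ag_one = ag_mul y x.
Proof. by rewrite ag_left_invertive ag_mul1. Qed.

Lemma fuzzy_ag_subgroup_le1 (R : realType) (G : agGroup)
    (mu : fuzzy_subset R G) (hmu : fuzzy_ag_subgroup mu) (a : G) :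
  (mu a <= mu ag_one)%O.
Proof.
case: hmu => muM muV.
have := muM (ag_inv a) a.
(* As mu(a) <= mu(a^-1), the minimum of the two is mu(a), while the product a^-1 a is e. *)
by rewrite ag_mulV (Order.POrderTheory.min_r (muV a)).
Qed.

Lemma fuzzy_ag_subgroup_le_mulC (R : realType) (G : agGroup)
    (mu : fuzzy_subset R G) (hmu : fuzzy_ag_subgroup mu) (x y : G) :
  (mu (ag_mul x y) <= mu (ag_mul y x))%O.
Proof.
have := hmu.1 (ag_mul x y) ag_one.
by rewrite ag_mulC1 Order.POrderTheory.min_l ?fuzzy_ag_subgroup_le1.
Qed.

Theorem proposition1 (R : realType) (G : agGroup) (mu : fuzzy_subset R G)
    (hmu : fuzzy_ag_subgroup mu) (x y : G) :
  mu (x * y)%AG = mu (y * x)%AG.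
Proof.
by apply: Order.POrderTheory.le_anti; rewrite !fuzzy_ag_subgroup_le_mulC.
Qed.
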